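(* If a hyperplane arrangement $\mathcal A=\mathcal A(\alpha)\subset\mathbb P^\ell$ has non-trivial weak perspective representations up to rank $k+1$, then the module of logarithmic derivations $D(\mathcal A)$ has projective dimension at least $k-1$. Equivalently, if $\mathcal A$ is not $k$-generated, then $D(\mathcal A)$ has projective dimension at least $k-1$.
   Context: $\mathbb K$ is a field of characteristic zero, $V=\mathbb K^{\ell+1}$, $\mathbb P^\ell=\mathbb P(V)$, $S=\mathbb K[x_0,\dots,x_\ell]$. A hyperplane arrangement $\mathcal A=\mathcal A(\alpha)$ is given by a map $\alpha:\{1,\dots,n\}\to V^*$, $i\mapsto\alpha_i$, whose values are linear forms defining pairwise distinct hyperplanes $H_i=\mathbb V(\alpha_i)\subset\mathbb P^\ell$; $Q=\prod_i\alpha_i$. $M(\alpha)$ is the $(\ell+1)\times n$ matrix whose columns are the coefficient vectors of the $\alpha_i$, and $\mathcal M(\alpha)$ is the linear matroid on $\{1,\dots,n\}$ of its columns. A flat of $\mathcal M(\alpha)$ is identified with the linear subspace of $\mathbb P^\ell$ that is the intersection of its hyperplanes; its rank is its codimension (the empty subspace is said to have codimension $\ell+1$). $D(\mathcal A)=\{\theta\in\mathrm{Der}_{\mathbb K}(S):\theta(Q)\in\langle Q\rangle\}$, a graded $S$-module; projective dimension is over $S$. The relation space is $\mathcal R(\mathcal A)=\ker M(\alpha)\subset\mathbb K^n$; the length of a relation is its number of nonzero entries. $\mathcal A$ is $k$-generated ($k\ge3$) if $\mathcal R(\mathcal A)$ is generated by relations of length $k$. Truncation: $\mathcal N^{[m]}$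 is the matroid whose independent sets are the independent sets of $\mathcal N$ of size at most $m$. Weak order: $\mathcal N\ge\mathcal M$ if every dependent set of $\mathcal N$ is dependent in $\mathcal M$. A map $\beta:\{1,\dots,n\}\to V^*$ is a weak representation of $\mathcal M(\alpha)$ up to rank $m$ if $\mathcal M(\alpha)^{[m]}\ge\mathcal M(\beta)^{[m]}$. A hyperplane $H_0=\mathbb V(\alpha_0)$ is in rank $m$ general linear position with respect to $\mathcal A$ if no flat of $\mathcal M(\alpha)$ of rank at most $m$ is contained in $H_0$. Arrangements $\mathcal A(\alpha)$, $\mathcal A'(\beta)$ not containing $H_0$ are perspective from $H_0$ if their restrictions to $H_0$ agree; after rescaling the forms, $\beta_j=\alpha_j+\lambda_j\alpha_0$ for some $\lambda\in\mathbb K^n$. A weak perspective representation of $\mathcal A(\alpha)$ up to rank $m$ (from $H_0$) is a weak representation $\beta$ of $\mathcal M(\alpha)$ up to rank $m$ that is perspective to $\alpha$ from a hyperplane $H_0$ in rank $m$ general linear position with respect to $\mathcal A(\alpha)$; these are recorded by the vectors $\lambda$. The trivial ones are those with $\lambda=(\alpha_1(\mathbf v),\dots,\alpha_n(\mathbf v))$ for some $\mathbf v\in\mathbb K^{\ell+1}$. The space of non-trivial weak perspective representations up to rank $m$ is the space of weak perspective representations up to rank $m$ modulo the trivial ones (up to isomorphism it does not depend on $H_0$), and $\mathcal A$ has non-trivial ones if this quotient is nonzero.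
   Formalization: The second sentence is false as stated (four generic lines in P^2, k=3: not 3-generated, but pd ≤ 1); it is proved with ''not (k+1)-generated'' in place of ''not k-generated'', and ''generated by relations of length k'' is read as length at most k. *)

(* Defs.v *)
From HB Require Import structures.
From mathcomp Require Import all_boot all_order all_algebra.
From mathcomp Require Import mpoly.
From mathcomp Require Import boolp functions.

Set Implicit Arguments.
Unset Strict Implicit.
Unset Printing Implicit Defensive.

Import GRing.Theory.
Local Open Scope ring_scope.

Section ProjectiveDimension.
Variable R : pzRingType.

Definition projective (P : lmodType R) : Prop :=
  forall (M N : lmodType R) (g : {linear M -> N}) (f : {linear P -> N}),
    (forall y, exists x, g x = y) ->
    exists h : {linear P -> M}, forall x, g (h x) = f x.

(* 0 -> P d -> ... -> P 1 -> P 0 -> M -> 0; the complex is indexed by all of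
   nat and vanishes beyond degree d. *)
Definition projective_resolution (M : lmodType R) (d : nat)
    (P : nat -> lmodType R) (delta : forall i, {linear P i.+1 -> P i})
    (eps : {linear P 0%N -> M}) : Prop :=
  [/\ forall i, projective (P i),
      forall y, exists x, eps x = y,
      forall x, eps x = 0 <-> exists y, delta 0%N y = x,
      forall i x, delta i x = 0 <-> exists y, delta i.+1 y = x &
      forall i, (d < i)%N -> forall x : P i, x = 0].

Definition projdim_le (M : lmodType R) (d : nat) : Prop :=
  exists (P : nat -> lmodType R) (delta : forall i, {linear P i.+1 -> P i})
         (eps : {linear P 0%N -> M}),
    projective_resolution d delta eps.

(* Infinite projective dimension satisfies [projdim_ge M m] for every m. *)
Definition projdim_ge (M : lmodType R) (m : nat) : Prop :=
  forall d, projdim_le M d -> (m <= d)%N.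

End ProjectiveDimension.

(* V = K^(l+1) is 'rV[K]_l.+1; a linear form on V is given by its column of
   coefficients a : 'cV[K]_l.+1, with value (v *m a) 0 0 at v.  Subspaces of
   P(V) are represented by the corresponding linear subspaces of V, the empty
   one by 0. *)
Section Arrangements.
Variables (K : fieldType) (l n : nat).
Implicit Types (a : 'cV[K]_l.+1) (alpha beta : 'I_n -> 'cV[K]_l.+1).
Implicit Types (I F : {set 'I_n}).

Definition form_at a (v : 'rV[K]_l.+1) : K := (v *m a) 0 0.

Definition hyperplane a : {vspace 'rV[K]_l.+1} := lker (linfun (mulmxr a)).

Definition arrangement alpha : Prop :=
  (forall i, alpha i != 0) /\
  (forall i j, i != j -> hyperplane (alpha i) != hyperplane (alpha j)).

Definition columns alpha I : seq 'cV[K]_l.+1 := [seq alpha i | i <- enum I].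

(* Matroids on 'I_n are given by their families of independent sets. *)
Definition linear_matroid alpha : {set {set 'I_n}} :=
  [set I : {set 'I_n} | free (columns alpha I)].

Definition truncation (N : {set {set 'I_n}}) (m : nat) : {set {set 'I_n}} :=
  [set I in N | (#|I| <= m)%N].

Definition weak_ge (N M : {set {set 'I_n}}) : Prop :=
  forall I, I \notin N -> I \notin M.

Definition weak_representation alpha (m : nat) beta : Prop :=
  weak_ge (truncation (linear_matroid alpha) m)
          (truncation (linear_matroid beta) m).

Definition rank alpha I : nat := \dim <<columns alpha I>>%VS.

Definition is_flat alpha F : Prop :=
  forall i, rank alpha (i |: F) = rank alpha F -> i \in F.

Definition flat_space alpha F : {vspace 'rV[K]_l.+1} :=
  (\bigcap_(i in F) hyperplane (alpha i))%VS.

(* The empty flat (flat_space = 0) counts: being contained in every H_0, it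
   rules out general position in its rank l+1. *)
Definition general_position alpha (m : nat) (alpha0 : 'cV[K]_l.+1) : Prop :=
  alpha0 != 0 /\
  forall F, is_flat alpha F -> (rank alpha F <= m)%N ->
    ~~ (flat_space alpha F <= hyperplane alpha0)%VS.

Definition perspective alpha (alpha0 : 'cV[K]_l.+1) (lambda : 'rV[K]_n) :
    'I_n -> 'cV[K]_l.+1 :=
  fun j => alpha j + lambda 0 j *: alpha0.

Definition weak_perspective alpha (m : nat) (alpha0 : 'cV[K]_l.+1)
    (lambda : 'rV[K]_n) : Prop :=
  general_position alpha m alpha0 /\
  weak_representation alpha m (perspective alpha alpha0 lambda).

Definition trivial_perspective alpha (lambda : 'rV[K]_n) : Prop :=
  exists v : 'rV[K]_l.+1, forall j, lambda 0 j = form_at (alpha j) v.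

Definition has_nontrivial_from alpha (m : nat) (alpha0 : 'cV[K]_l.+1) : Prop :=
  exists lambda : 'rV[K]_n,
    weak_perspective alpha m alpha0 lambda /\ ~ trivial_perspective alpha lambda.

Definition has_nontrivial_weak_perspective alpha (m : nat) : Prop :=
  exists alpha0 : 'cV[K]_l.+1, has_nontrivial_from alpha m alpha0.

Definition coef_matrix alpha : 'M[K]_(l.+1, n) :=
  \matrix_(i, j) alpha j i 0.

Definition relation_space alpha : {vspace 'cV[K]_n} :=
  lker (linfun (mulmx (coef_matrix alpha))).

Definition relation_length (c : 'cV[K]_n) : nat := #|[set i | c i 0 != 0]|.

(* Length at most k: three concurrent lines have a single relation, of length
   3, and count as k-generated for all k >= 3. *)
Definition generated alpha (k : nat) : Prop :=
  exists s : seq 'cV[K]_n,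
    (forall c, c \in s -> (relation_length c <= k)%N) /\
    <<s>>%VS = relation_space alpha.

Definition form_poly a : {mpoly K[l.+1]} := \sum_(i < l.+1) a i 0 *: 'X_i.

Definition defining_poly alpha : {mpoly K[l.+1]} :=
  \prod_(i < n) form_poly (alpha i).

Definition derivation (theta : {mpoly K[l.+1]} -> {mpoly K[l.+1]}) : Prop :=
  (forall (c : K) p q, theta (c *: p + q) = c *: theta p + theta q) /\
  (forall p q, theta (p * q) = theta p * q + p * theta q).

Definition logarithmic alpha (theta : {mpoly K[l.+1]} -> {mpoly K[l.+1]}) :
    Prop :=
  derivation theta /\
  exists f, theta (defining_poly alpha) = f * defining_poly alpha.

(* The regular module S^o makes the functions S -> S a module over S. *)
Definition logarithmic_pred alpha :
    {pred {mpoly K[l.+1]} -> {mpoly K[l.+1]}^o} :=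
  fun theta => `[< logarithmic alpha theta >].

Lemma logarithmic_submod alpha : submod_closed (logarithmic_pred alpha).
Proof.
split.
  have E0 p : (0 : {mpoly K[l.+1]} -> {mpoly K[l.+1]}^o) p = 0 by [].
  apply/asboolP; split; first split.
  - by move=> c p q; rewrite E0 scaler0 addr0.
  - by move=> p q; rewrite !E0 mul0r mulr0 addr0.
  - by exists 0; rewrite E0 mul0r.
move=> s t1 t2 /asboolP[[lin1 der1] [f1 log1]] /asboolP[[lin2 der2] [f2 log2]].
have E p : (s *: t1 + t2) p = s * t1 p + t2 p by [].
apply/asboolP; split; first split.
- move=> c p q; rewrite !E lin1 lin2 mulrDr scalerDr -scalerAr.
  by rewrite -!addrA; congr (_ + _); rewrite addrCA.
- by move=> p q; rewrite !E der1 der2 !mulrDr mulrDl !mulrA (mulrC p s) addrACA.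
- by exists (s * f1 + f2); rewrite E log1 log2 mulrDl mulrA.
Qed.

HB.instance Definition _ alpha :=
  GRing.isSubmodClosed.Build {mpoly K[l.+1]}
    ({mpoly K[l.+1]} -> {mpoly K[l.+1]}^o) (logarithmic_pred alpha)
    (logarithmic_submod alpha).

Definition logder alpha : Type :=
  {theta : {mpoly K[l.+1]} -> {mpoly K[l.+1]}^o
     | theta \in logarithmic_pred alpha}.

HB.instance Definition _ alpha := SubChoice.on (logder alpha).
HB.instance Definition _ alpha :=
  [SubChoice_isSubLmodule of logder alpha by <:].

End Arrangements.

(* Main.v *)
From HB Require Import structures.
Require Import Defs.
From mathcomp Require Import all_boot all_order all_algebra.
From mathcomp Require Import mpoly.
From mathcomp Require freeg.
From mathcomp Require Import boolp.

(** Write S for the polynomial ring. The module of logarithmic derivations is a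
    second syzygy: there is an exact sequence
      0 -> D(A) -> S^(l+1) + S^n -> S^n -> C -> 0
    whose middle map sends (b, g) to the vector with entries
    theta_b(alpha_j) - alpha_j g_j, where theta_b = \sum_i b_i d/dx_i.
    If A is not (k+1)-generated, some lambda in K^n is orthogonal to all
    relations of length at most k+1 but not to all relations.  Among the points
    v of V such that lambda is not orthogonal to the relations among the forms
    vanishing at v, take one with the fewest vanishing forms.  These forms have
    rank at least k+1, and some multiple of lambda is nonzero in C and killed by
    all of them.  So C has a nonzero element killed by a regular sequence of
    k+1 linear forms, which forces its projective dimension to be at least k+1,
    and that of D(A) to be at least k-1. *)

Set Implicit Arguments.
Unset Strict Implicit.
Unset Printing Implicit Defensive.

Import GRing.Theory.
Local Open Scope ring_scope.

(** * Regular sequences and projective dimension *)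

Section RegularSequences.
Import freeg.
Variables (R : comNzRingType) (y : nat -> R).

Definition ideal_mul (M : lmodType R) (j : nat) (x : M) : Prop :=
  exists a : nat -> M, x = \sum_(i < j) y i *: a i.

(** Weak regularity: the quotient of [M] by the sequence may be zero, so the zero terms of a finite
    resolution qualify as well. *)
Definition regular (M : lmodType R) (q : nat) : Prop :=
  forall j (x : M), (j < q)%N -> ideal_mul j (y j *: x) -> ideal_mul j x.

Lemma ideal_mul0 (M : lmodType R) (x : M) : ideal_mul 0 x -> x = 0.
Proof. by case=> a ->; rewrite big_ord0. Qed.

Lemma ideal_mulD (M : lmodType R) j (x x' : M) :
  ideal_mul j x -> ideal_mul j x' -> ideal_mul j (x + x').
Proof.
case=> a -> [a' ->]; exists (fun i => a i + a' i).
by rewrite -big_split; apply: eq_bigr => i _; rewrite scalerDr.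
Qed.

Lemma ideal_mul_linear (M N : lmodType R) (f : {linear M -> N}) j (x : M) :
  ideal_mul j x -> ideal_mul j (f x).
Proof.
case=> a ->; exists (f \o a); rewrite linear_sum.
by apply: eq_bigr => i _; rewrite linearZ.
Qed.

Lemma ideal_mulZ (M : lmodType R) j c (x : M) :
  ideal_mul j x -> ideal_mul j (c *: x).
Proof.
case=> a ->; exists (fun i => c *: a i); rewrite scaler_sumr.
by apply: eq_bigr => i _; rewrite !scalerA mulrC.
Qed.

Lemma ideal_mulN (M : lmodType R) j (x : M) : ideal_mul j x -> ideal_mul j (-
  x).
Proof. by move=> h; rewrite -scaleN1r; apply: ideal_mulZ. Qed.

Lemma ideal_mulB (M : lmodType R) j (x x' : M) :
  ideal_mul j x -> ideal_mul j x' -> ideal_mul j (x - x').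
Proof. by move=> ? ?; apply/ideal_mulD/ideal_mulN. Qed.

Lemma ideal_mulSP (M : lmodType R) j (x : M) :
  ideal_mul j.+1 x <-> exists a, ideal_mul j (x - y j *: a).
Proof.
split=> [[a ->]|[a [b e]]].
  by exists (a j), a; rewrite big_ord_recr /= addrK.
exists (fun i => if i == j then a else b i); rewrite big_ord_recr /= eqxx.
rewrite (eq_bigr (fun i : 'I_j => y i *: b i)) => [|i _]; last first.
  by rewrite (ltn_eqF (ltn_ord i)).
by rewrite -e subrK.
Qed.

(** Membership in the ideal can be tested on each coefficient separately. *)
Lemma regular_freeg (T : choiceType) q :
  regular R^o q -> regular {freeg T / R} q.
Proof.
move=> reg j x jq [a xa].
have /choice[b xb] z : exists b : nat -> R, coeff z x = \sum_(i < j) y i * b i.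
  apply: (reg j (coeff z x : R^o) jq); exists (fun i => coeff z (a i)).
  move/(congr1 (coeff z)): xa; rewrite coeffZ raddf_sum.
  by under eq_bigr do rewrite /= coeffZ.
(* Summing over the support [dom x] keeps the witnesses finitely supported. *)
exists (fun i => \sum_(z <- dom x) << b z i *g z >>).
under eq_bigr do rewrite scaler_sumr; rewrite exchange_big /=.
rewrite -[LHS]freeg_sumE; apply: eq_bigr => z _.
apply/eqP/freeg_eqP => w; rewrite coeffU raddf_sum /= xb mulr_suml.
by apply: eq_bigr => i _; rewrite coeffZ coeffU mulrA.
Qed.

Lemma regular_retract (M N : lmodType R) (f : {linear M -> N})
    (g : {linear N -> M}) q : cancel f g -> regular N q -> regular M q.
Proof.
move=> fK reg j x jq h; rewrite -[x]fK; apply/ideal_mul_linear/reg => //.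
by rewrite -linearZ; apply: ideal_mul_linear.
Qed.

Lemma regular_row m q : regular R^o q -> regular 'rV[R]_m q.
Proof.
move=> reg j x jq [a xa].
have /choice[b xb] h : exists b : nat -> R, x 0 h = \sum_(i < j) y i * b i.
  apply: (reg j (x 0 h : R^o) jq); exists (fun i => a i 0 h).
  move/rowP/(_ h): xa; rewrite mxE summxE.
  by under eq_bigr do rewrite mxE.
exists (fun i => \row_h b h i); apply/rowP => h; rewrite xb summxE.
by apply: eq_bigr => i _; rewrite !mxE.
Qed.

Lemma regular_pair (M N : lmodType R) q :
  regular M q -> regular N q -> regular (M * N)%type q.
Proof.
move=> regM regN j [x x'] jq h.
have /(regM _ _ jq)[a xa] : ideal_mul j (y j *: x) by exact:
  (ideal_mul_linear fst h).
have /(regN _ _ jq)[a' xa'] : ideal_mul j (y j *: x') by exact: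
  (ideal_mul_linear snd h).
exists (fun i => (a i, a' i)); rewrite [RHS]surjective_pairing !raddf_sum /=.
by rewrite xa xa'.
Qed.

Section FreeLift.
Variable (M : lmodType R).

(** The canonical surjection from the free module on the underlying set of [M]. *)
Definition free_lift : {freeg M / R} -> M := fglift id.

Lemma free_lift_linear : linear free_lift.
Proof.
have fD : {morph free_lift : x x' / x - x'} by apply: lift_is_additive.
have f0 : free_lift 0 = 0 by rewrite -{1}(subrr 0) fD subrr.
have fA : {morph free_lift : x x' / x + x'}.
  by move=> x x'; rewrite -{1}[x']opprK -[- x']sub0r !fD f0 sub0r opprK.
move=> c x x'; rewrite fA; congr (_ + _).
rewrite -{2}[x]freeg_sumE !(big_morph _ fA f0) scaler_sumr.
by apply: eq_bigr => z _; rewrite /free_lift !liftU scalerA.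
Qed.

HB.instance Definition _ :=
  GRing.isLinear.Build R {freeg M / R} M _ free_lift free_lift_linear.

Lemma free_lift_surj x : exists z, free_lift z = x.
Proof. by exists (<< x >>); rewrite /free_lift liftU scale1r. Qed.

End FreeLift.

(** Lifting the identity through [free_lift] makes [P] a retract of a free module. *)
Lemma regular_projective (P : lmodType R) q :
  projective P -> regular R^o q -> regular P q.
Proof.
move=> projP reg.
have [h hK] := projP _ _ (@free_lift P) (@idfun P) (@free_lift_surj P).
exact: (@regular_retract _ _ h (free_lift (M:=P)) _ hK (regular_freeg reg)).
Qed.

(* Dimension shifting in elementary terms.  Replacing the socle element [x] of
   the cokernel of [F 1 -> F 0] by the class of a preimage of [y j *: x] trades
   one element of the regular sequence for one step along the complex. *)
Section Chase.
Variables (F : nat -> lmodType R) (delta : forall i, {linear F i.+1 -> F i}).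
Hypothesis deltaK : forall i x, delta i (delta i.+1 x) = 0.
Hypothesis exactF :
  forall i x, delta i x = 0 -> exists y, delta i.+1 y = x.
Variable q : nat.
Hypothesis regF : forall i, regular (F i) q.

Let deltaB i x x' : delta i (x - x') = delta i x - delta i x'.
Proof. exact: linearB. Qed.

Let deltaZ i c x : delta i (c *: x) = c *: delta i x.
Proof. exact: linearZ. Qed.

(** Reducing modulo one more ring element costs one degree of exactness. If [delta x] is [y j *: a]
    modulo the first [j] elements, then regularity makes [a] a cycle there, so [a] is some
    [delta b], and [x - y j *: b] is a cycle modulo the first [j] elements. *)
Lemma exact_mod j i (x : F i.+1) : (j <= i)%N -> (j <= q)%N ->
  ideal_mul j (delta i x) -> exists u, ideal_mul j (x - delta i.+1 u).
Proof.
elim: j i x => [|j IHj] i x ji jq.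
  move/ideal_mul0/exactF=> [u <-]; exists u; rewrite subrr.
  by exists (fun=> 0); rewrite big_ord0.
case: i x ji => // i x ji /ideal_mulSP[a xa].
have /regF : ideal_mul j (y j *: delta i a).
  have /ideal_mulN := ideal_mul_linear (delta i) xa.
  by rewrite deltaB deltaZ /= deltaK sub0r opprK.
move=> /(_ jq) /IHj[] //; first exact: ltnW.
move=> b ab.
have : ideal_mul j (delta i.+1 (x - y j *: b)).
  have := ideal_mulD xa (ideal_mulZ (y j) ab).
  by rewrite deltaB deltaZ /= scalerBr addrA subrK.
move=> /IHj[||u xu]; [exact: ltnW|exact: ltnW|exists u].
by apply/ideal_mulSP; exists b; rewrite addrAC.
Qed.

Definition boundary_mod j i (x : F i) : Prop :=
  exists u, ideal_mul j (x - delta i u).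

Lemma shift_socle j (x : F j) : (j < q)%N ->
  ~ boundary_mod j x ->
  (forall h, (j <= h < q)%N -> boundary_mod j (y h *: x)) ->
  exists2 x' : F j.+1, ~ boundary_mod j.+1 x' &
    forall h, (j.+1 <= h < q)%N -> boundary_mod j.+1 (y h *: x').
Proof.
move=> jq nx sx; have [|x' xx'] := sx j; first by rewrite leqnn.
(* Here [y j *: x] is [delta x'] modulo the first [j] elements. If [x'] were a boundary up to
   [y j *: c], then [y j *: (x - delta c)] would vanish modulo them, and regularity would make [x] a
   boundary. *)
exists x' => [[u /ideal_mulSP[c x'uc]]|h /andP[jh hq]].
  apply: nx; exists c; apply: regF => //.
  have := ideal_mulD xx' (ideal_mul_linear (delta j) x'uc).
  by rewrite !deltaB !deltaZ /= deltaK subr0 addrA subrK scalerBr.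
have [|b xb] := sx h; first by rewrite hq ltnW.
(* This difference is a cycle modulo the first [j] elements because its two images are both
   [y h * y j] times [x]. *)
have /exact_mod[//||u xu] : ideal_mul j (delta j (y h *: x' - y j *: b)).
- have := ideal_mulB (ideal_mulZ (y j) xb) (ideal_mulZ (y h) xx').
  rewrite deltaB !deltaZ /= !scalerBr !scalerA mulrC opprB.
  by rewrite addrC addrA subrK.
- exact: ltnW.
exists u; apply/ideal_mulSP; exists b; by rewrite addrAC.
Qed.

(** Iterating [shift_socle] gives in each degree up to [q] an element that is not a boundary modulo
    part of the sequence, so none of these terms is zero; for [d < q] this contradicts the vanishing
    in degree [d.+1]. *)
Lemma complex_long (x : F 0) : ~ (exists u, delta 0 u = x) ->
  (forall h, (h < q)%N -> exists u, delta 0 u = y h *: x) ->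
  forall d, (forall i, (d < i)%N -> forall z : F i, z = 0) -> (q <= d)%N.
Proof.
move=> nx sx d Fd.
have step j : (j <= q)%N -> exists2 x : F j, ~ boundary_mod j x &
    forall h, (j <= h < q)%N -> boundary_mod j (y h *: x).
  elim: j => [_|j IHj jq]; last first.
    by have [z nz sz] := IHj (ltnW jq); apply: shift_socle nz sz.
  exists x => [[u /ideal_mul0/subr0_eq e]|h /sx[u e]]; first by apply: nx;
    exists u.
  by exists u, (fun=> 0); rewrite e subrr big_ord0.
rewrite leqNgt; apply/negP => dq; have [z + _] := step _ dq.
by apply; exists 0, (fun=> 0); rewrite big1 => [|i _]; [apply:
  Fd|rewrite scaler0].
Qed.

End Chase.
End RegularSequences.

(** * Relations and perspectives *)

Section LinearAlgebra.
Variable K : fieldType.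

(** Subtracting the projection onto [U] kills [U] but not [x]; [w] is a coordinate of the result
    that is nonzero at [x]. *)
Lemma separating_form m (U : {vspace 'cV[K]_m}) (x : 'cV[K]_m) : x \notin U ->
  exists2 w : 'rV[K]_m, forall u, u \in U -> w *m u = 0 & w *m x != 0.
Proof.
move=> xU; pose p v := v - projv U v.
have pD : {morph p : v w / v + w}.
  by move=> v w; rewrite /p linearD opprD addrACA.
have pZ c : {morph p : v / c *: v} by move=> v; rewrite /p linearZ scalerBr.
have p0 : p 0 = 0 by rewrite /p linear0 subr0.
have /matrix0Pn[i [j]] : p x != 0.
  by apply: contra xU; rewrite subr_eq0 => /eqP ->; apply: memv_proj.
rewrite ord1 => pxi.
pose w := \row_h p (delta_mx h 0) i 0.
have wE v : w *m v = (p v i 0)%:M.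
  apply/matrixP => a b; rewrite !ord1 mxE [RHS]mxE eqxx mulr1n.
  rewrite {2}[v]matrix_sum_delta.
  under [in RHS]eq_bigr do rewrite big_ord1.
  rewrite (big_morph p pD p0) summxE; apply: eq_bigr => h _.
  by rewrite pZ !mxE mulrC.
exists w => [u uU|]; rewrite wE.
  by rewrite /p projv_id // subrr mxE raddf0.
by apply: contra pxi => /eqP/matrixP/(_ 0 0); rewrite !mxE eqxx mulr1n => ->.
Qed.

(** In characteristic zero the images of the naturals below [size p] are distinct, and they are more
    numerous than the degree allows as roots. *)
Lemma poly_nonroot (charK : [pchar K] =i pred0) (p : {poly K}) :
  p != 0 -> exists t, p.[t] != 0.
Proof.
move=> p0; apply: contrapT => /forallNP np.
pose s := [seq i%:R : K | i <- iota 0 (size p)].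
have us : uniq s.
  rewrite map_inj_uniq ?iota_uniq // => i j.
  wlog ij : i j / (i <= j)%N => [W e|/eqP].
    by case/orP: (leq_total i j) => h; [apply: W|apply/esym/W].
  rewrite eq_sym -subr_eq0 -natrB // ((pcharf0P K).1 charK) subn_eq0 => ji.
  by apply/eqP; rewrite eqn_leq ij.
have /(max_poly_roots p0)/(_ us) : all (root p) s.
  by apply/allP => t _; apply/eqP/eqP; rewrite -[_ == _]negbK; apply/negP/np.
by rewrite size_map size_iota ltnn.
Qed.

Variables (l n : nat) (alpha : 'I_n -> 'cV[K]_l.+1).
Implicit Types (lambda : 'rV[K]_n) (c : 'cV[K]_n) (v u : 'rV[K]_l.+1).
Implicit Types (X Y : {set 'I_n}).

Lemma mem_relation_space c :
  (c \in relation_space alpha) = (coef_matrix alpha *m c == 0).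
Proof. by rewrite memv_ker lfunE. Qed.

Lemma mul_coef_matrix c : coef_matrix alpha *m c = \sum_j c j 0 *: alpha j.
Proof.
apply/matrixP => i j; rewrite ord1 !mxE summxE.
by apply: eq_bigr => h _; rewrite !mxE mulrC.
Qed.

Lemma mul_coef_matrix_delta j : coef_matrix alpha *m delta_mx j 0 = alpha j.
Proof. by apply/matrixP => a b; rewrite -colE ord1 !mxE. Qed.

Lemma form_atD a v v' : form_at (l := l) a (v + v') =
  form_at a v + form_at a v' :> K.
Proof. by rewrite /form_at mulmxDl mxE. Qed.

Lemma form_atZ a t v : form_at (l := l) a (t *: v) = t * form_at a v :> K.
Proof. by rewrite /form_at -scalemxAl mxE. Qed.

Lemma relation_form_at c v : c \in relation_space alpha ->
  \sum_j c j 0 * form_at (alpha j) v = 0.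
Proof.
rewrite mem_relation_space mul_coef_matrix => /eqP/(congr1 (mulmx v)).
rewrite mulmx0 mulmx_sumr => /matrixP/(_ 0 0); rewrite !mxE summxE => {2}<-.
by apply: eq_bigr => j _; rewrite -scalemxAr mxE.
Qed.

Lemma memv_columns Y a : reflect
  (exists c : 'I_n -> K, a = \sum_(j in Y) c j *: alpha j)
  (a \in <<columns alpha Y>>%VS).
Proof.
rewrite span_def big_map big_enum /=.
apply: (iffP memv_sumP) => [[vs vsP ->]|[c ->]].
  have /choice[c cP] j : exists t, j \in Y -> vs j = t *: alpha j.
    case jY: (j \in Y); last by exists 0.
    by have /vlineP[t ->] := vsP j jY; exists t.
  by exists c; apply: eq_bigr => j /cP.
exists (fun j => c j *: alpha j) => // j _; exact: rpredZ (memv_line _).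
Qed.

Definition supported c Y : Prop := forall j, j \notin Y -> c j 0 = 0.

Definition annihilates lambda Y : Prop :=
  forall c, c \in relation_space alpha -> supported c Y -> lambda *m c = 0.

Lemma annihilatesS lambda X Y : X \subset Y ->
  annihilates lambda Y -> annihilates lambda X.
Proof.
move=> /subsetP XY annY c rc cX; apply: annY => // j jY.
by apply: cX; apply: contra jY; apply: XY.
Qed.

(** Double orthogonality: if the restriction of [lambda] to [Y] were not a vector of values of the
    forms, a functional would separate it from all such vectors, and its coefficients would be a
    relation not orthogonal to [lambda]. *)
Lemma annihilates_form lambda Y : annihilates lambda Y ->
  exists u, forall j, j \in Y -> lambda 0 j = form_at (alpha j) u.
Proof.
move=> ann.
pose restr (x : 'I_n -> K) : 'cV[K]_n := \col_j (if j \in Y then x j else 0).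
pose T u := restr (fun j => form_at (alpha j) u).
have T_linear : linear T.
  move=> t u u'; apply/colP => j; rewrite !mxE form_atD form_atZ.
  by case: ifP; rewrite // mulr0 addr0.
pose TL := HB.pack_for {linear 'rV[K]_l.+1 -> 'cV[K]_n} T
  (GRing.isLinear.Build _ _ _ _ T T_linear).
have [|] := boolP (restr (lambda 0) \in limg (linfun TL)).
  case/memv_imgP => u _ /colP e; exists u => j jY.
  by have := e j; rewrite lfunE !mxE jY.
case/separating_form => w wT /eqP[].
have wE (x : 'I_n -> K) : (w *m restr x) 0 0 = \sum_(j in Y) w 0 j * x j.
  rewrite mxE [RHS]big_mkcond; apply: eq_bigr => j _.
  by rewrite mxE; case: ifP; rewrite ?mulr0.
(* Pairing [w] with the values of the forms at the unit vectors of V yields the coordinates of this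
   relation. *)
have /ann annw : restr (w 0) \in relation_space alpha.
  rewrite mem_relation_space mul_coef_matrix; apply/eqP/colP => i.
  have /wT/matrixP/(_ 0 0) : T (delta_mx 0 i) \in limg (linfun TL).
    by rewrite -[T _](lfunE TL) memv_img ?memvf.
  rewrite wE [RHS]mxE => e; rewrite summxE [RHS]mxE -[RHS]e [RHS]big_mkcond.
  apply: eq_bigr => j _.
  rewrite !mxE; case: ifP => _; rewrite ?mul0r //; congr (_ * _).
  by rewrite /form_at -rowE mxE.
have /matrixP/(_ 0 0) : lambda *m restr (w 0) = 0.
  by apply: annw => j /negbTE jY; rewrite mxE jY.
rewrite [RHS]mxE => e; apply/matrixP => a b; rewrite !ord1 wE [RHS]mxE -[RHS]e.
rewrite mxE big_mkcond; apply: eq_bigr => j _; rewrite !mxE mulrC.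
by case: ifP; rewrite ?mulr0 // mul0r.
Qed.

(** * Short relations, generation and weak perspective representations *)

Definition annihilates_short lambda (m : nat) : Prop :=
  forall c, c \in relation_space alpha -> (relation_length c <= m)%N ->
    lambda *m c = 0.

Lemma relation_length_supported c Y : supported c Y ->
  (relation_length c <= #|Y|)%N.
Proof.
move=> cY; apply/subset_leq_card/subsetP => j; rewrite inE.
by apply: contraR => /cY ->.
Qed.

(** A list of short relations with span of maximal dimension spans all short relations. If it misses
    some relation, a functional vanishing on the span separates that relation. *)
Lemma not_generatedP m : ~ generated alpha m <->
  exists lambda, annihilates_short lambda m /\ ~ annihilates lambda setT.
Proof.
split=> [ngen|[lambda [short nann] [s [sm sR]]]]; last first.
  apply: nann => c; rewrite -sR => cs _.
  have := (coord_span (X := in_tuple s) cs) => ->.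
  rewrite mulmx_sumr big1 // => i _; rewrite -scalemxAr short ?scaler0 //.
    by rewrite -sR memv_span ?mem_nth.
  by rewrite sm ?mem_nth.
pose short c := (c \in relation_space alpha) && (relation_length c <= m)%N.
pose P d := `[< exists s, all short s /\ \dim <<s>>%VS = d >].
have exP : exists d, P d by exists (\dim <<[::] : seq 'cV[K]_n>>%VS);
  apply/asboolP; exists [::].
have ubP d : P d -> (d <= \dim {: 'cV[K]_n})%N.
  by move=> /asboolP[s [_ <-]]; rewrite dimvS ?subvf.
have [d /asboolP[s [/allP ss sd]] dmax] := ex_maxnP exP ubP.
have span_short c : short c -> c \in <<s>>%VS.
  move=> sc; have sub : (<<s>> <= <<c :: s>>)%VS by rewrite span_cons addvSr.
  have /dmax : P (\dim <<c :: s>>).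
    by apply/asboolP; exists (c :: s); split=> //=; rewrite sc; apply/allP.
  rewrite -sd => le; have /eqP -> : <<s>>%VS == <<c ::
    s>>%VS by rewrite eqEdim sub.
  by rewrite memv_span ?mem_head.
have sR : (<<s>> <= relation_space alpha)%VS.
  by apply/span_subvP => c /ss/andP[].
have : ~~ (relation_space alpha <= <<s>>)%VS.
  apply/negP => Rs; apply: ngen; exists s; split=> [c /ss/andP[]//|].
  by apply/eqP; rewrite eqEsubv sR Rs.
case/subvPn => r rR /separating_form[lambda ls /eqP lr].
exists lambda; split=> [c cR cm|/(_ r rR)]; first by apply/ls/span_short/andP.
by move=> H; apply: lr; apply: H => j; rewrite inE.
Qed.

Lemma trivial_perspectiveP lambda :
  trivial_perspective alpha lambda <-> annihilates lambda setT.
Proof.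
split=> [[u lu] c rc _|/annihilates_form[u lu]]; last first.
  by exists u => j; apply: lu; rewrite inE.
apply/matrixP => a b; rewrite !ord1 [RHS]mxE -(relation_form_at u rc) mxE.
by apply: eq_bigr => j _; rewrite lu mulrC.
Qed.

(** The closure [F] of [I] is a flat of rank at most [m], and any form in the span of [I] vanishes
    on all of its space. *)
Lemma general_position_span m alpha0 (I : {set _}) :
  general_position alpha m alpha0 ->
  (#|I| <= m)%N -> alpha0 \notin <<columns alpha I>>%VS.
Proof.
move=> [_ gp] Im; pose F := [set j | alpha j \in <<columns alpha I>>%VS].
have IF : I \subset F.
  by apply/subsetP => j jI; rewrite inE memv_span // map_f ?mem_enum.
have spanF : <<columns alpha F>>%VS = <<columns alpha I>>%VS.
  apply/eqP; rewrite eqEsubv; apply/andP; split; apply/span_subvP =>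
    _ /mapP[j + ->].
    by rewrite mem_enum inE.
  by rewrite mem_enum => /(subsetP IF) jF; rewrite memv_span ?map_f ?mem_enum.
have /gp : is_flat alpha F.
  move=> i; rewrite /rank => e.
  have : <<columns alpha F>>%VS == <<columns alpha (i |: F)>>%VS.
    rewrite eqEdim e leqnn andbT; apply/span_subvP => _ /mapP[j + ->].
    by rewrite mem_enum => jF; rewrite memv_span // map_f // mem_enum inE jF
      orbT.
  rewrite spanF => /eqP e'; rewrite inE e' memv_span // map_f // mem_enum.
  by rewrite setU11.
have -> : (rank alpha F <= m)%N.
  rewrite /rank spanF (leq_trans (dim_span _)) // size_map -cardE //.
move=> /(_ isT); apply: contra => /memv_columns[c ->].
apply/subvP => v; rewrite memv_ker lfunE /= => vF.
rewrite mulmx_sumr big1 // => j jI; rewrite -scalemxAr.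
have /subvP/(_ v vF) : (flat_space alpha F <= hyperplane (alpha j))%VS.
  by apply: bigcapv_inf (subsetP IF j jI) _.
by rewrite memv_ker lfunE /= => /eqP ->; rewrite scaler0.
Qed.

(** Freeness of a list speaks of positions in [enum I]; this criterion speaks of vectors indexed by
    ['I_n], so that dependencies become relations. *)
Lemma free_columnsP (beta : 'I_n -> 'cV[K]_l.+1) (I : {set _}) : reflect
  (forall c, supported c I -> \sum_j c j 0 *: beta j = 0 -> c = 0)
  (free (columns beta I)).
Proof.
have sumE c : supported c I ->
    \sum_j c j 0 *: beta j = \sum_(j <- enum I) c j 0 *: beta j.
  move=> cI; rewrite big_enum /= [RHS]big_mkcond; apply: eq_bigr => j _.
  by case: ifP => // /negbT/cI ->; rewrite scale0r.
rewrite /columns; set t := enum I.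
have tI j : (j \in t) = (j \in I) by rewrite mem_enum.
apply: (iffP idP) => [|H].
  move=> fr c cI; rewrite sumE // => e.
  have /freeP fr' : free (in_tuple [seq beta i | i <- t]) by [].
  apply/colP => j; rewrite mxE; case: (boolP (j \in I)) => [|/cI//].
  rewrite -tI => jt.
  pose x0 := j; have szt : (index j t < size [seq beta i | i <- t])%N.
    by rewrite size_map index_mem.
  have := fr' (fun i => c (nth x0 t i) 0) _ (Ordinal szt).
  rewrite /= nth_index //; apply; rewrite -[RHS]e.
  rewrite (big_nth x0) big_mkord -(size_map beta).
  by apply: eq_bigr => i _; rewrite (nth_map x0) // -(size_map beta).
suff /freeP : forall k : 'I_(size [seq beta i | i <- t]) -> K,
    \sum_i k i *: (in_tuple [seq beta i | i <- t])`_i = 0 ->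
    forall i, k i = 0 by [].
(* For an index outside [I] the position equals the size of [t], so [insub] fails and the entry
   defaults to 0. *)
move=> k e i; pose c : 'cV[K]_n := \col_j oapp k 0 (insub (index j t)).
have ts : size [seq beta i | i <- t] = size t by rewrite size_map.
have lt_t (h : 'I_(size [seq beta i | i <- t])) : (h < size t)%N by rewrite -ts.
have [x0 _] : exists x0 : 'I_n, x0 \in t.
  have : (0 < size t)%N by apply: leq_ltn_trans (lt_t i).
  by case: (t) => // x t' _; exists x; rewrite mem_head.
have ck (h : 'I_(size [seq beta i | i <- t])) : c (nth x0 t h) 0 = k h.
  by rewrite mxE index_uniq ?enum_uniq // valK.
rewrite -ck; suff -> : c = 0 by rewrite mxE.
apply: H => [j|].
  rewrite -tI mxE => jt; rewrite insubN // -leqNgt ts.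
  by rewrite leqNgt index_mem.
rewrite sumE => [|j].
  rewrite (big_nth x0) big_mkord -ts -[RHS]e; apply: eq_bigr => h _.
  by rewrite ck (nth_map x0).
rewrite -tI mxE => jt; rewrite insubN // -leqNgt ts.
by rewrite leqNgt index_mem.
Qed.

Lemma sum_perspective alpha0 lambda c :
  \sum_j c j 0 *: perspective alpha alpha0 lambda j =
  \sum_j c j 0 *: alpha j + (lambda *m c) 0 0 *: alpha0.
Proof.
rewrite mxE scaler_suml -big_split; apply: eq_bigr => j _ /=.
by rewrite /perspective scalerDr scalerA mulrC.
Qed.

(** Short relations orthogonal to [lambda] remain relations of the perspective forms. Conversely,
    the support of a short relation [c] is dependent for [alpha], hence for [beta]; the resulting
    dependency [e] is orthogonal to [lambda] by general position, and subtracting a multiple of it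
    shortens [c]. *)
Lemma weak_perspectiveP m alpha0 lambda : general_position alpha m alpha0 ->
  weak_perspective alpha m alpha0 lambda <-> annihilates_short lambda m.
Proof.
move=> gp; set beta := perspective alpha alpha0 lambda.
split=> [[_ wr] c|short]; last first.
  split=> // I; rewrite !inE; apply: contra => /andP[/free_columnsP frI Im].
  rewrite Im andbT; apply/free_columnsP => c cI rc; apply: frI => //.
  rewrite sum_perspective rc add0r short ?mxE ?scale0r //.
    by rewrite mem_relation_space mul_coef_matrix rc.
  exact: leq_trans (relation_length_supported cI) Im.
have [d] := ubnP (relation_length c); elim: d c => // d IHd c cd rc cm.
have [->|c0] := eqVneq c 0; first by rewrite mulmx0.
pose I := [set i | c i 0 != 0].
have cI : supported c I by move=> j; rewrite inE negbK => /eqP.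
have /free_columnsP : ~~ free (columns beta I).
  have := wr I; rewrite !inE cm !andbT; apply; apply/free_columnsP => /(_ c cI).
  by move: rc; rewrite mem_relation_space mul_coef_matrix =>
    /eqP rc /(_ rc)/eqP; apply/negP.
move=> /existsNP[e /not_implyP[eI /not_implyP[re /eqP e0]]].
(* Otherwise the dependency could be solved for [alpha0], placing it in the span of the forms in
   [I]. *)
have le0 : (lambda *m e) 0 0 = 0.
  apply/eqP; apply: contraT => le.
  case/negP: (general_position_span gp cm).
  move: re; rewrite sum_perspective addrC => /eqP; rewrite addr_eq0 => /eqP re.
  rewrite -[alpha0](scalerK le) re rpredZ // rpredN; apply: rpred_sum => j _.
  case: (boolP (j \in I)) => [jI|/eI ->]; last by rewrite scale0r mem0v.
  by rewrite rpredZ // memv_span // map_f ?mem_enum.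
have {}re : e \in relation_space alpha.
  by rewrite mem_relation_space mul_coef_matrix -[X in _ == X]re
    /beta sum_perspective le0 scale0r addr0.
have {}le0 : lambda *m e = 0 by apply/matrixP => a b; rewrite !ord1 le0 mxE.
have /matrix0Pn[i [j]] := e0; rewrite ord1 => ei.
(* The factor cancels entry [i], and [e] is supported on [I], so the support shrinks properly. *)
pose c' := c - (c i 0 / e i 0) *: e.
have /proper_card lt : [set i | c' i 0 != 0] \proper I.
  apply/properP; split; last first.
    exists i; first by rewrite inE; apply: contra ei => /eqP ci;
      rewrite eI // inE ci eqxx.
    by rewrite inE !mxE divfK // subrr eqxx.
  apply/subsetP => h; rewrite inE; apply: contraR => hI.
  by rewrite !mxE (cI h hI) (eI h hI) mulr0 subrr.
have : lambda *m c' = 0.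
  apply: IHd; first exact: leq_trans lt cd.
    by rewrite rpredB // rpredZ.
  exact: leq_trans (ltnW lt) cm.
by rewrite mulmxBr -scalemxAr le0 scaler0 subr0.
Qed.

Lemma has_nontrivialP m alpha0 : general_position alpha m alpha0 ->
  has_nontrivial_from alpha m alpha0 <-> ~ generated alpha m.
Proof.
move=> gp; rewrite not_generatedP; split=> -[lambda [wp nt]]; exists lambda;
  split.
- exact/(weak_perspectiveP _ gp).
- by rewrite -trivial_perspectiveP.
- exact/(weak_perspectiveP _ gp).
- by rewrite trivial_perspectiveP.
Qed.

(** The independent forms are chosen one by one. If [q < m] of them spanned the rest, each further
    form would give a relation of length at most [q.+1], and every relation on [X] would be a sum of
    short ones. *)
Lemma annihilates_rank_ge lambda m X : annihilates_short lambda m ->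
  ~ annihilates lambda X -> exists s : nat -> 'I_n,
    (forall i, (i < m)%N -> s i \in X) /\
    (forall j, (j < m)%N ->
       alpha (s j) \notin (\sum_(i < j) <[alpha (s i)]>)%VS).
Proof.
move=> short nann.
(* [s] is total, so even an empty choice needs a default index. *)
have [i0 _] : exists i0 : 'I_n, i0 \in X.
  apply: contrapT => nX; apply: nann => c _ cX.
  suff -> : c = 0 by rewrite mulmx0.
  by apply/colP => j; rewrite mxE cX //; apply/negP => jX; apply: nX; exists j.
suff H q : (q <= m)%N -> exists s : nat -> 'I_n,
    (forall i, (i < q)%N -> s i \in X) /\
    (forall j, (j < q)%N ->
       alpha (s j) \notin (\sum_(i < j) <[alpha (s i)]>)%VS) by exact:
         H (leqnn m).
elim: q => [|q IHq] qm; first by exists (fun=> i0).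
have [s [sX sfree]] := IHq (ltnW qm).
have [i iX iS] : exists2 i, i \in X &
    alpha i \notin (\sum_(h < q) <[alpha (s h)]>)%VS.
  apply: contrapT => /forall2NP nX; apply: nann => r rr rX.
  have /choice[b bP] i : exists b : 'I_q -> K,
      i \in X -> alpha i = \sum_h b h *: alpha (s h).
    have [] := nX i; first by exists (fun=> 0).
    move/negP; rewrite negbK => /memv_sumP[vs vsP ai].
    have /choice[b bP] h : exists t, vs h = t *: alpha (s h).
      by apply/vlineP/vsP.
    by exists b => _; rewrite ai; apply: eq_bigr => h _; rewrite bP.
  pose f i : 'cV[K]_n := \sum_h b i h *: delta_mx (s h) 0.
  have Mf i : coef_matrix alpha *m f i = \sum_h b i h *: alpha (s h).
    rewrite mulmx_sumr; apply: eq_bigr => h _.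
    by rewrite -scalemxAr mul_coef_matrix_delta.
  have fs i j : j \notin [set s h | h : 'I_q] -> f i j 0 = 0.
    move=> js; rewrite summxE big1 // => h _; rewrite !mxE.
    have -> : (j == s h) = false by apply: contraNF js => /eqP ->; apply:
      imset_f.
    by rewrite mulr0.
  have card_s : (#|[set s h | h : 'I_q]| <= q)%N.
    by rewrite (leq_trans (leq_imset_card _ _)) ?card_ord.
  have le0 i : i \in X -> lambda *m (delta_mx i 0 - f i) = 0.
    move=> iX; apply: short.
      by rewrite mem_relation_space mulmxBr mul_coef_matrix_delta Mf -bP //
        subrr.
    apply: leq_trans (relation_length_supported (Y := i |: [set s h | h :
      'I_q]) _) _.
      move=> j; rewrite !inE negb_or => /andP[/negbTE ji js].
      by rewrite !mxE ji fs // subrr.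
    rewrite cardsU1 (leq_trans (leq_add (leq_b1 _) card_s)) //.
  (* The first sum consists of relations of length at most [q.+1]; the second is then itself a
     relation, supported on the [q] chosen indices. *)
  have rE : r = \sum_(i in X) r i 0 *: (delta_mx i 0 - f i) +
                \sum_(i in X) r i 0 *: f i.
    rewrite -big_split {1}[r]matrix_sum_delta [RHS]big_mkcond.
    apply: eq_bigr => i _; rewrite big_ord1 /= -scalerDr subrK.
    by case: ifP => // /negbT/rX ->; rewrite scale0r.
  have S1 : lambda *m (\sum_(i in X) r i 0 *: (delta_mx i 0 - f i)) = 0.
    by rewrite mulmx_sumr big1 // => i iX; rewrite -scalemxAr le0 ?scaler0.
  rewrite rE mulmxDr S1 add0r; apply: short.
    have : r \in relation_space alpha by [].
    rewrite !mem_relation_space {1}rE mulmxDr mulmx_sumr big1 ?add0r // => i iX.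
    rewrite -scalemxAr mulmxBr mul_coef_matrix_delta Mf -bP // subrr.
    by rewrite scaler0.
  apply: leq_trans (relation_length_supported (Y := [set s h | h : 'I_q]) _) _.
    move=> j js; rewrite summxE big1 // => i _.
    by rewrite mxE fs // mulr0.
  exact: leq_trans card_s (ltnW qm).
exists (fun h => if (h < q)%N then s h else i); split=> [h _|h].
  by case: ifP => // /sX.
have sumE j : (j <= q)%N ->
    (\sum_(h < j) <[alpha (if (h < q)%N then s h else i)]> =
     \sum_(h < j) <[alpha (s h)]>)%VS.
  move=> jq; apply: eq_bigr => x _.
  by rewrite (leq_trans (ltn_ord x) jq).
rewrite ltnS => hq; rewrite sumE //.
by move: hq; rewrite leq_eqVlt => /orP[/eqP->|hq]; rewrite ?ltnn // hq sfree.
Qed.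

(** * Points with a minimal set of vanishing forms *)

Definition zeros v : {set 'I_n} := [set i | form_at (alpha i) v == 0].

(** Move [v] in a direction [w] that annihilates the forms of [Y] but not [alpha i]. All but
    finitely many nonzero steps make no new form vanish. *)
Lemma zeros_shrink (charK : [pchar K] =i pred0) v i Y : Y \subset zeros v ->
  i \in zeros v -> alpha i \notin <<columns alpha Y>>%VS ->
  exists2 v', Y \subset zeros v' & zeros v' \proper zeros v.
Proof.
move=> /subsetP Yv iv /separating_form[w wY wi].
pose g j : {poly K} := (form_at (alpha j) v)%:P + (form_at (alpha j) w) *: 'X.
have gE j t : (g j).[t] = form_at (alpha j) (v + t *: w).
  by rewrite !hornerE form_atD form_atZ mulrC.
(* The factor ['X] excludes the zero step; each [g j] is nonzero because its value at 0 is. *)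
have [|t] := poly_nonroot charK (p := 'X * \prod_(j in ~: zeros v) g j).
  rewrite mulf_eq0 polyX_eq0 /=; apply/prodf_neq0 => j; rewrite !inE => jv.
  apply: contra jv => /eqP/(congr1 (horner^~ 0)).
  by rewrite gE scale0r addr0 horner0 => ->.
rewrite hornerM hornerX horner_prod mulf_eq0 negb_or =>
  /andP[t0 /prodf_neq0 nz].
exists (v + t *: w); last first.
  apply/properP; split; last first.
    exists i => //; rewrite inE form_atD form_atZ.
    move: iv; rewrite inE => /eqP ->; rewrite add0r mulf_neq0 //.
    apply: contra wi => /eqP e; apply/eqP/matrixP => a b.
    by rewrite !ord1 [RHS]mxE -[RHS]e.
  apply/subsetP => j; rewrite inE; apply: contraLR => jv.
  by have := nz j; rewrite gE inE; apply.
apply/subsetP => j jY; have := Yv j jY; rewrite !inE form_atD form_atZ =>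
  /eqP ->.
rewrite add0r /form_at wY ?mxE ?mulr0 // memv_span //.
by rewrite map_f ?mem_enum.
Qed.

(** When the span of [Y] misses one of the vanishing forms, [Y] lies in a strictly smaller zero set,
    to which minimality applies. *)
Lemma minimal_zeros (charK : [pchar K] =i pred0) lambda :
  ~ annihilates lambda setT -> exists v,
    ~ annihilates lambda (zeros v) /\
    forall Y i, Y \subset zeros v -> i \in zeros v ->
      alpha i \notin <<columns alpha Y>>%VS -> annihilates lambda Y.
Proof.
move=> nann.
pose P d := `[< exists v, ~ annihilates lambda (zeros v) /\ #|zeros v| = d >].
have exP : exists d, P d.
  exists #|zeros 0|; apply/asboolP; exists 0; split=> // ann; apply: nann.
  suff <- : zeros 0 = setT by [].
  by apply/setP => i; rewrite !inE /form_at mul0mx mxE eqxx.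
have [d /asboolP[v [nv vd]] dmin] := ex_minnP exP.
exists v; split=> // Y i Yv iv /(zeros_shrink charK Yv iv)[v' Yv' lt].
apply: annihilatesS Yv' _; apply: contrapT => nv'.
have /dmin : P #|zeros v'| by apply/asboolP; exists v'.
by rewrite -vd leqNgt proper_card.
Qed.

End LinearAlgebra.

(** * Ideals of linear forms *)

Section LinearForms.
Variables (K : fieldType) (l : nat).
Local Notation S := {mpoly K[l.+1]}.
Implicit Types (a : 'cV[K]_l.+1) (U : {vspace 'cV[K]_l.+1}) (f g : S).

Lemma mpoly_ring_ind (P : S -> Prop) :
    (forall c, P c%:MP) -> (forall i, P 'X_i) ->
    (forall f g, P f -> P g -> P (f + g)) ->
    (forall f g, P f -> P g -> P (f * g)) ->
  forall f, P f.
Proof.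
move=> PC PX PD PM.
elim/mpolyind => [|c m f _ _ Pf]; first by rewrite -mpolyC0.
apply: (PD) Pf; rewrite -mul_mpolyC; apply: (PM) => //.
rewrite mpolyXE_id; elim/big_ind: _ => [||i _]; [by rewrite -mpolyC1|exact:
  PM|].
elim: (m i) => [|d IHd]; first by rewrite expr0 -mpolyC1.
by rewrite exprS; apply: PM.
Qed.

Lemma form_poly_is_linear : linear (@form_poly K l).
Proof.
move=> c a b; rewrite /form_poly scaler_sumr -big_split.
by apply: eq_bigr => i _; rewrite !mxE scalerDl scalerA.
Qed.

HB.instance Definition _ :=
  GRing.isLinear.Build K 'cV[K]_l.+1 S _ (@form_poly K l) form_poly_is_linear.

Lemma form_poly_delta i : form_poly (delta_mx i 0) = 'X_i :> S.
Proof.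
rewrite /form_poly (bigD1 i) //= mxE !eqxx scale1r big1 ?addr0 // => j ji.
by rewrite mxE (negbTE ji) scale0r.
Qed.

Lemma meval_form_poly (v : 'rV[K]_l.+1) a :
  (form_poly a).@[fun i => v 0 i] = form_at a v.
Proof.
rewrite /form_at mxE raddf_sum; apply: eq_bigr => i _ /=.
by rewrite mevalZ mevalXU mulrC.
Qed.

Lemma form_poly_eq0 a : (form_poly a == 0) = (a == 0).
Proof.
apply/eqP/eqP => [e|->]; last by rewrite linear0.
apply/colP => i; have := meval_form_poly (delta_mx 0 i) a.
by rewrite e meval0 /form_at -rowE !mxE.
Qed.

(* A retraction of the polynomial ring onto a subring, whose kernel is the
   ideal generated by the linear forms in [U]. *)
Definition subst U : S -> S :=
  comp_mpoly [tuple form_poly (delta_mx i 0 - projv U (delta_mx i 0)) | i <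
    l.+1].

HB.instance Definition _ U := GRing.RMorphism.on (subst U).

Lemma subst_form_poly U a : subst U (form_poly a) = form_poly (a - projv U a).
Proof.
rewrite [a]matrix_sum_delta (linear_sum (projv U)) -sumrB !linear_sum raddf_sum.
apply: eq_bigr => i _; rewrite !big_ord1 /=.
have -> c b : projv U (c *: b) = c *: projv U b by rewrite linearZ.
rewrite -scalerBr !linearZ /=.
rewrite /subst comp_mpolyZ; congr (_ *: _).
by rewrite form_poly_delta comp_mpolyXU -tnth_nth tnth_mktuple.
Qed.

Lemma subst_form_poly_eq0 U a : (subst U (form_poly a) == 0) = (a \in U).
Proof.
rewrite subst_form_poly form_poly_eq0 subr_eq0.
by apply/eqP/idP => [->|/projv_id ->//]; apply: memv_proj.
Qed.

Section Ideal.
Variables (y : nat -> 'cV[K]_l.+1) (j : nat).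
Let I := @ideal_mul S (fun i => form_poly (y i)) S^o j.
Let U := (\sum_(i < j) <[y i]>)%VS.

Lemma form_poly_ideal a : a \in U -> I (form_poly a).
Proof.
case/memv_sumP => vs vsP ->.
have /choice[c cP] (i : 'I_j) : exists c, vs i = c *: y i.
  exact/vlineP/vsP.
exists (fun h => oapp (fun i => (c i)%:MP) 0 (insub h)).
rewrite linear_sum; apply: eq_bigr => i _.
by rewrite valK cP linearZ /= -mul_mpolyC mulrC.
Qed.

(** [subst U] kills the generators, and it moves every polynomial by an element of the ideal, as can
    be checked on variables, sums and products. *)
Lemma ideal_substP f : I f <-> subst U f = 0.
Proof.
split=> [[b ->]|f0].
  rewrite raddf_sum big1 // => i _.
  apply: etrans (rmorphM (subst U) (form_poly (y i)) (b i)) _.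
  suff /eqP e : subst U (form_poly (y i)) == 0 by rewrite /= e mul0r.
  rewrite subst_form_poly_eq0.
  exact/(subvP (sumv_sup i isT (subvv _)))/memv_line.
have : I (subst U f - f).
  elim/mpoly_ring_ind: f {f0} => [c|i|f g If Ig|f g If Ig].
  - rewrite [subst U _]comp_mpolyC subrr.
    by exists (fun=> 0); rewrite big1 // => i _; rewrite scaler0.
  - rewrite -form_poly_delta subst_form_poly -linearB addrAC subrr sub0r
    linearN.
    apply: (@ideal_mulN _ _ S^o).
    exact/form_poly_ideal/memv_proj.
  - by rewrite rmorphD opprD addrACA; apply: ideal_mulD.
  rewrite rmorphM.
  have -> : subst U f * subst U g - f * g =
      subst U f *: (subst U g - g : S^o) + g *: (subst U f - f : S^o).
    by rewrite /GRing.scale /= !mulrBr addrA (mulrC g (subst U f)) subrK (mulrC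
      g).
  by apply: ideal_mulD; apply: ideal_mulZ.
by rewrite f0 sub0r => /(@ideal_mulN _ _ S^o); rewrite opprK.
Qed.

End Ideal.

(** [subst] takes values in a domain and does not kill a form outside the span of the earlier
    ones. *)
Lemma regular_forms (y : nat -> 'cV[K]_l.+1) q :
    (forall j, (j < q)%N -> y j \notin (\sum_(i < j) <[y i]>)%VS) ->
  @regular S (fun i => form_poly (y i)) S^o q.
Proof.
move=> free_y j f jq /ideal_substP f0; apply/ideal_substP; move/eqP: f0.
by rewrite rmorphM mulf_eq0 subst_form_poly_eq0 (negbTE (free_y j jq)) => /eqP.
Qed.

Lemma form_poly_dvdP a f : subst <[a]> f = 0 -> exists g, f = form_poly a * g.
Proof.
have <- : (\sum_(i < 1) <[a]>)%VS = <[a]>%VS by rewrite big_ord1.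
by move=> /(ideal_substP (fun=> a))[b ->]; exists (b 0%N); rewrite big_ord1.
Qed.

Lemma subst_self a : subst <[a]> (form_poly a) = 0.
Proof. by apply/eqP; rewrite subst_form_poly_eq0 memv_line. Qed.

End LinearForms.

(** * The complex of logarithmic derivations *)

Section LogarithmicComplex.
Variables (K : fieldType) (l n : nat) (alpha : 'I_n -> 'cV[K]_l.+1).
Local Notation S := {mpoly K[l.+1]}.
Local Notation form j := (form_poly (alpha j)).
Implicit Types (theta : S -> S) (f g : S).

Lemma arrangement_independent : arrangement alpha ->
  forall i j, i != j -> alpha i \notin <[alpha j]>%VS.
Proof.
move=> [nz dist] i j /dist; apply: contra => /vlineP[c e].
have c0 : c != 0.
  by apply: contraTneq (nz i) => c0; rewrite e c0 scale0r eqxx.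
apply/eqP/vspaceP => v; rewrite !memv_ker !lfunE /= e -scalemxAr.
by rewrite scaler_eq0 (negbTE c0).
Qed.

Section Derivations.
Variable theta : S -> S.
Hypothesis der : derivation theta.

Lemma derivationD f g : theta (f + g) = theta f + theta g.
Proof. by have := der.1 1 f g; rewrite !scale1r. Qed.

Lemma derivation1 : theta 1 = 0.
Proof.
have := der.2 1 1; rewrite !mulr1 mul1r => /(congr1 (+%R^~ (- theta 1))).
by rewrite addrK subrr => <-.
Qed.

Lemma derivation0 : theta 0 = 0.
Proof.
have := derivationD 0 0; rewrite addr0 => /(congr1 (+%R^~ (- theta 0))).
by rewrite addrK subrr => <-.
Qed.

Lemma derivationZ c f : theta (c *: f) = c *: theta f.
Proof. by have := der.1 c f 0; rewrite derivation0 !addr0. Qed.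

Lemma derivationC c : theta c%:MP = 0.
Proof.
by rewrite -[c%:MP]mulr1 mul_mpolyC derivationZ derivation1 scaler0.
Qed.

Lemma derivation_form (b : 'cV[K]_l.+1) :
  theta (form_poly b) = \sum_i (b i 0)%:MP * theta 'X_i.
Proof.
rewrite (big_morph theta derivationD derivation0); apply: eq_bigr => i _.
by rewrite derivationZ mul_mpolyC.
Qed.

Lemma derivation_prod (I : Type) (r : seq I) (F : I -> S) (G : I -> S) :
  (forall i, theta (F i) = F i * G i) ->
  theta (\prod_(i <- r) F i) = (\sum_(i <- r) G i) * \prod_(i <- r) F i.
Proof.
move=> FG; elim: r => [|i r IHr]; first by rewrite !big_nil derivation1 mul0r.
rewrite !big_cons der.2 IHr FG mulrDl; congr (_ + _); last exact: mulrCA.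
by rewrite mulrA (mulrC (G i)).
Qed.

(** Modulo one form, the Leibniz rule leaves its derivative times the product of the other forms;
    that product is nonzero there since the hyperplanes are distinct. The converse is the
    logarithmic derivative of a product. *)
Lemma logarithmicP : arrangement alpha ->
  logarithmic alpha theta <-> forall j, exists g, theta (form j) = form j * g.
Proof.
move=> arrA; split=> [[_ [f log]] j|/choice[G GP]]; last first.
  by split=> //; exists (\sum_j G j); apply: derivation_prod.
apply: form_poly_dvdP; move: log; rewrite /defining_poly (bigD1 j) //= der.2.
move=> /(congr1 (subst <[alpha j]>)).
rewrite !(rmorphD, rmorphM) /= subst_self !(mul0r, mulr0, addr0) => /eqP.
rewrite mulf_eq0 => /orP[/eqP //|].
rewrite rmorph_prod => /prodf_eq0[i ij].
by rewrite subst_form_poly_eq0 (negbTE (arrangement_independent arrA ij)).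
Qed.

End Derivations.

Lemma derivation_inj theta theta' : derivation theta -> derivation theta' ->
  (forall i, theta 'X_i = theta' 'X_i) -> theta =1 theta'.
Proof.
move=> d d' e; elim/mpoly_ring_ind => [c|i|f g ef eg|f g ef eg] //.
- by rewrite !derivationC.
- by rewrite !derivationD // ef eg.
- by rewrite d.2 d'.2 ef eg.
Qed.

Definition partials (b : 'rV[S]_l.+1) : S -> S :=
  fun f => \sum_i b 0 i * f^`M(i).

Lemma partials_derivation b : derivation (partials b).
Proof.
split=> [c f g|f g]; rewrite /partials.
  rewrite scaler_sumr -big_split; apply: eq_bigr => i _.
  by rewrite mderivD mderivZ mulrDr -scalerAr.
rewrite mulr_suml mulr_sumr -big_split; apply: eq_bigr => i _ /=.
by rewrite mderivM mulrDr; congr (_ + _); [rewrite mulrA|apply: mulrCA].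
Qed.

Lemma partialsX b i : partials b 'X_i = b 0 i.
Proof.
rewrite /partials (bigD1 i) //= big1 => [|j ji]; rewrite mderivX mnm1E.
  by rewrite eqxx scale1r -[X in 'X_[X - _]]add0m addmK mpolyX0 mulr1 addr0.
by rewrite eq_sym (negbTE ji) scale0r mulr0.
Qed.

(** Exact division made total, with value 0 when [p] does not divide [f]. *)
Definition quotient (p f : S) : S :=
  if pselect (exists g, f = p * g) is left h then projT1 (cid h) else 0.

Lemma quotientK p f : (exists g, f = p * g) -> f = p * quotient p f.
Proof. by rewrite /quotient; case: pselect => // h _; case: (cid h). Qed.

Local Notation F0 := 'rV[S]_n.
Local Notation F1 := ('rV[S]_l.+1 * 'rV[S]_n)%type.

Definition jacobian (x : F1) : F0 :=
  \row_j (\sum_i (alpha j i 0)%:MP * x.1 0 i - form j * x.2 0 j).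

Lemma jacobian_is_linear : linear jacobian.
Proof.
move=> c x x'; apply/rowP => j; rewrite !mxE.
have -> : (c *: x + x').1 = c *: x.1 + x'.1 by [].
under eq_bigr do rewrite !mxE mulrDr mulrCA.
by rewrite big_split -mulr_sumr /= mulrDr mulrBr (mulrCA _ c) opprD addrACA.
Qed.

HB.instance Definition _ := GRing.isLinear.Build S F1 F0 _ jacobian
  jacobian_is_linear.

Lemma logderP (t : logder alpha) : logarithmic alpha (val t).
Proof. exact/asboolP/(valP t). Qed.

Definition coordinates (t : logder alpha) : F1 :=
  (\row_i val t 'X_i, \row_j quotient (form j) (val t (form j))).

Hypothesis arrA : arrangement alpha.

Lemma form_neq0 j : form j != 0.
Proof. by rewrite form_poly_eq0 arrA.1. Qed.

Lemma logder_form (t : logder alpha) j :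
  val t (form j) = form j * (coordinates t).2 0 j.
Proof.
rewrite mxE; apply: quotientK.
by have [d _] := logderP t; exact: (logarithmicP d arrA).1 (logderP t) j.
Qed.

Lemma coordinates_is_linear : linear coordinates.
Proof.
move=> c t t'; have vD : val (c *: t + t') = c *: val t + val t'.
  by rewrite linearP.
congr pair; apply/rowP => j; first by rewrite !mxE vD.
(* Linearity of a chosen quotient is checked after multiplying by the nonzero form. *)
apply: (mulfI (form_neq0 j)).
have := logder_form (c *: t + t') j; rewrite vD /= => <-.
rewrite [LHS]/(c * val t (form j) + val t' (form j)) !logder_form.
by rewrite !mxE mulrDr (mulrCA c).
Qed.

HB.instance Definition _ :=
  GRing.isLinear.Build S (logder alpha) F1 _ coordinates coordinates_is_linear.

Lemma coordinates_eq0 t : coordinates t = 0 -> t = 0.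
Proof.
move=> [/rowP t1 _]; apply: val_inj; apply/funext.
apply: (@derivation_inj (val t) (val (0 : logder alpha))).
- by have [] := logderP t.
- by have [] := logderP 0.
by move=> i; have := t1 i; rewrite !mxE.
Qed.

Lemma jacobian_coordinates t : jacobian (coordinates t) = 0.
Proof.
apply/rowP => j; rewrite [jacobian _ 0 j]mxE [RHS]mxE -logder_form.
have [d _] := logderP t; rewrite derivation_form //.
by rewrite -sumrB big1 // => i _; rewrite mxE subrr.
Qed.

Lemma jacobian_exact x : jacobian x = 0 -> exists t, coordinates t = x.
Proof.
move=> /rowP x0; have d := partials_derivation x.1.
have formE j : partials x.1 (form j) = form j * x.2 0 j.
  have := x0 j; rewrite [LHS]mxE [RHS]mxE => /subr0_eq <-.
  by rewrite derivation_form //; apply: eq_bigr => i _; rewrite partialsX.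
have lP : partials x.1 \in logarithmic_pred alpha.
  by apply/asboolP/(logarithmicP d arrA) => j; exists (x.2 0 j).
exists (Sub (partials x.1 : S -> S^o) lP : logder alpha).
case: x {x0 d} formE lP => b g /= formE lP; congr pair; apply/rowP => j.
  by rewrite mxE SubK partialsX.
apply: (mulfI (form_neq0 j)); rewrite -formE mxE SubK -quotientK //.
by exists (g 0 j).
Qed.

Section Complex.
Variables (P : nat -> lmodType S) (dP : forall i, {linear P i.+1 -> P i}).
Variable eps : {linear P 0 -> logder alpha}.

(** A resolution of the logarithmic derivations is spliced onto the two free modules, which shifts
    it by two degrees. *)
Definition log_complex (i : nat) : lmodType S :=
  match i with 0 => F0 | 1 => F1 | i.+2 => P i end.

Definition log_delta (i : nat) :
    {linear log_complex i.+1 -> log_complex i} :=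
  match i with
  | 0 => jacobian : {linear F1 -> F0}
  | 1 => coordinates \o eps : {linear P 0 -> F1}
  | i.+2 => dP i
  end.

End Complex.

(** The spliced complex is exact in positive degrees and vanishes beyond [d.+2], so [complex_long]
    bounds its length from below. *)
Lemma projdim_lower_bound d q (y : nat -> 'cV[K]_l.+1) (z : F0) :
    (forall j, (j < q)%N -> y j \notin (\sum_(i < j) <[y i]>)%VS) ->
    ~ (exists u, jacobian u = z) ->
    (forall h, (h < q)%N -> exists u, jacobian u = form_poly (y h) *: z) ->
  projdim_le (logder alpha) d -> (q <= d.+2)%N.
Proof.
move=> /regular_forms regS nz sz [P [dP [eps [projP epsS epsE dPE Pd]]]].
apply: (@complex_long S (fun h => form_poly (y h)) (log_complex P)
  (log_delta dP eps) _ _ q _ z) => //.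
- case=> [|[|i]] x /=; first exact: jacobian_coordinates.
    have -> : eps (dP 0 x) = 0 by apply/epsE; exists x.
    exact: linear0.
  by apply/dPE; exists x.
- case=> [|[|i]] x /=; last by move/dPE.
    by move=> /jacobian_exact[t <-]; have [u <-] := epsS t; exists u.
  by move=> /coordinates_eq0/epsE.
- case=> [|[|i]] /=; first exact: regular_row.
    by apply: regular_pair; apply: regular_row.
  exact: regular_projective.
- by case=> [|[|i]] //=; rewrite !ltnS => /Pd.
Qed.

End LogarithmicComplex.

(** * A socle element of the cokernel *)

Section Socle.
Variables (K : fieldType) (l n : nat) (alpha : 'I_n -> 'cV[K]_l.+1).
Local Notation S := {mpoly K[l.+1]}.
Local Notation form j := (form_poly (alpha j)).
Implicit Types (f g : S) (X Y : {set 'I_n}) (t : seq 'I_n).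
Variable lambda : 'rV[K]_n.
Let lam : 'rV[S]_n := \row_j (lambda 0 j)%:MP.

Definition boundary (x : 'rV[S]_n) : Prop := exists u, jacobian alpha u = x.

Lemma boundaryD x x' : boundary x -> boundary x' -> boundary (x + x').
Proof. by move=> [u <-] [u' <-]; exists (u + u'); rewrite linearD. Qed.

Lemma boundaryZ f x : boundary x -> boundary (f *: x).
Proof. by move=> [u <-]; exists (f *: u); rewrite linearZ. Qed.

(** On [Y], [lambda] is given by evaluation at some [u], so the constant derivation [u] times the
    product [p] accounts for these entries. Outside [Y], the error [mu j] times [p] is divisible by
    the form itself. *)
Lemma boundary_annihilates Y : annihilates alpha lambda Y ->
  boundary ((\prod_(i in ~: Y) form i) *: lam).
Proof.
move=> /annihilates_form[u uP]; set p := \prod_(i in ~: Y) form i.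
pose mu j := lambda 0 j - form_at (alpha j) u.
exists (\row_i (p * (u 0 i)%:MP),
  \row_j (if j \in Y then 0
          else - (mu j)%:MP * \prod_(i in ~: Y | i != j) form i)).
apply/rowP => j; rewrite !mxE.
have -> : \sum_i (alpha j i 0)%:MP * (\row_i (p * (u 0 i)%:MP)) 0 i =
    p * (form_at (alpha j) u)%:MP.
  rewrite /form_at mxE raddf_sum mulr_sumr; apply: eq_bigr => i _.
  by rewrite mxE mulrCA -mpolyCM (mulrC (alpha j i 0)).
case: ifP => [jY|/negbT jY]; first by rewrite mulr0 subr0 uP.
rewrite mulNr mulrN opprK mulrCA.
have <- : p = form j * \prod_(i in ~: Y | i != j) form i.
  by rewrite /p (bigD1 j) ?inE.
by rewrite mulrC -mulrDl -mpolyCD mulrC /mu addrC subrK.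
Qed.

(** Pair an image of [jacobian] with [c] and evaluate at [v]: the derivation part dies because [c]
    is a relation, the rest because the forms in its support vanish at [v]. *)
Lemma boundary_eval f v c : boundary (f *: lam) ->
  c \in relation_space alpha -> supported c (zeros alpha v) ->
  f.@[fun i => v 0 i] *: (lambda *m c) = 0.
Proof.
move=> [[b g] /rowP e] rc cv; set ev := meval (fun i => v 0 i).
suff : ev f * (lambda *m c) 0 0 = 0.
  by move=> h; apply/matrixP => i j; rewrite !ord1 [LHS]mxE h mxE.
have E j : ev f * lambda 0 j =
    (\sum_i alpha j i 0 * ev (b 0 i)) - form_at (alpha j) v * ev (g 0 j).
  have := congr1 ev (e j); rewrite !mxE /= /ev mevalB !mevalM mevalC => <-.
  rewrite meval_form_poly raddf_sum; congr (_ - _).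
  by apply: eq_bigr => i _ /=; rewrite mevalM mevalC.
rewrite mxE mulr_sumr; under eq_bigr do rewrite mulrA E mulrBl.
rewrite sumrB [X in _ - X]big1 ?subr0 => [|j _]; last first.
  case: (boolP (j \in zeros alpha v)) => [|/cv ->]; last by rewrite mulr0.
  by rewrite inE => /eqP ->; rewrite !mul0r.
under eq_bigr do rewrite mulr_suml; rewrite exchange_big /=.
rewrite big1 // => i _; move: rc; rewrite mem_relation_space => /eqP/colP/(_ i).
rewrite !mxE => h; apply: etrans (_ : ev (b 0 i) * 0 = 0); last exact: mulr0.
rewrite -[in RHS]h mulr_sumr; apply: eq_bigr => j _.
by rewrite mxE mulrA (mulrC (ev _)).
Qed.

Lemma not_uniq_perm (T : eqType) (s : seq T) : ~~ uniq s ->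
  exists x s', perm_eq s [:: x, x & s'].
Proof.
elim: s => //= x s IHs; rewrite negb_and negbK => /orP[xs|/IHs[z [s' ss']]].
  by exists x, (rem x s); rewrite perm_cons perm_to_rem.
exists z, (x :: s'); apply: (@perm_trans _ (x :: [:: z, z & s'])).
  by rewrite perm_cons.
by rewrite -(perm_catCA [:: z; z] [:: x] s').
Qed.

Lemma prod_undup (s : seq 'I_n) (F : 'I_n -> S) :
  exists f, \prod_(i <- s) F i = f * \prod_(i in s) F i.
Proof.
suff [f ->] : exists f, \prod_(i <- s) F i = f * \prod_(i <- undup s) F i.
  exists f; rewrite big_uniq ?undup_uniq //; congr (_ * _).
  by apply: eq_bigl => i; rewrite mem_undup.
elim: s => [|i s [f IHs]] /=; first by exists 1; rewrite !big_nil mulr1.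
rewrite big_cons IHs; case: ifP => _.
  by exists (F i * f); rewrite mulrA.
by exists f; rewrite big_cons mulrCA.
Qed.

Variable v : 'rV[K]_l.+1.
Let X := zeros alpha v.
(** Nonzero at [v], so [boundary_eval] applies to multiples by [s]; it also supplies the factors
    outside [X] that [boundary_annihilates] requires. *)
Let s := \prod_(i in ~: X) form i.
Hypothesis X_min : forall Y i, Y \subset X -> i \in X ->
  alpha i \notin <<columns alpha Y>>%VS -> annihilates alpha lambda Y.

(** Induction on the number of forms of [X] missing from [t]. By length some form is repeated. If
    the missing forms do not span it, minimality makes [lambda] annihilate them; otherwise one copy
    is expanded in missing forms. *)
Lemma boundary_prod t : {subset t <= X} -> (#|X| < size t)%N ->
  boundary ((s * \prod_(i <- t) form i) *: lam).
Proof.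
have [d] := ubnP #|[set i in X | i \notin t]|.
elim: d t => // d IHd t td tX Xt.
have /not_uniq_perm[i [t' tt']] : ~~ uniq t.
  apply: contraTN Xt => ut; rewrite -leqNgt -(card_uniqP ut).
  exact/subset_leq_card/subsetP.
have it : i \in t by rewrite (perm_mem tt') mem_head.
set Y := [set i in X | i \notin t] in td.
have [|nY] := boolP (alpha i \in <<columns alpha Y>>%VS); last first.
  have YX : Y \subset X by apply/subsetP => j; rewrite inE => /andP[].
  have [f ->] := prod_undup t (fun i => form i).
  (* The complement of [Y] consists of the indices outside [X] and the entries of [t]. *)
  have -> : s * (f * \prod_(j in t) form j) = f * \prod_(j in ~: Y) form j.
    rewrite mulrCA; congr (_ * _); rewrite [RHS](bigID (mem X)) /= mulrC.
    have XE j : (form_at (alpha j) v == 0) = (j \in X) by rewrite inE.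
    congr (_ * _); apply: eq_bigl => j; rewrite !inE !XE.
      by case: (boolP (j \in t)) => [/tX ->|_] //; case: (j \in X).
    by case: (j \in X); rewrite ?andbF.
  by rewrite -scalerA; apply/boundaryZ/boundary_annihilates/(X_min YX (tX _
    it)).
case/memv_columns => c ci; rewrite (perm_big _ tt') big_cons /=.
(* The second copy of the form stays, so each summand keeps every form of [t] and gains a missing
   one. *)
have -> : s * (form i * \prod_(j <- i :: t') form j) =
    \sum_(j in Y) (c j)%:MP * (s * \prod_(h <- j :: i :: t') form h).
  rewrite {1}ci linear_sum mulr_suml mulr_sumr; apply: eq_bigr => j _.
  by rewrite linearZ /= -mul_mpolyC [in RHS]big_cons -mulrA mulrCA.
rewrite scaler_suml; elim/big_ind: _ => [||j jY].
- by exists 0; rewrite linear0.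
- exact: boundaryD.
rewrite -scalerA; apply/boundaryZ/IHd.
- rewrite -ltnS; apply: leq_trans td; rewrite ltnS; apply: proper_card.
  apply/properP; split; last first.
    by exists j => //; rewrite inE mem_head andbF.
  apply/subsetP => h; rewrite !inE (perm_mem tt') !inE !negb_or.
  by case/and4P=> -> _ -> ->.
- move=> h; rewrite !in_cons => /or3P[/eqP ->|/eqP ->|ht]; last 1 first.
  + by apply: tX; rewrite (perm_mem tt') !in_cons ht !orbT.
  + by move: jY; rewrite in_set => /andP[].
  + exact: tX it.
by rewrite (leq_trans Xt) // (perm_size tt').
Qed.

(** Starting from [s *: lam], multiply by forms of [X] as long as the result is not a boundary. By
    [boundary_prod] this stops, and the last element is killed by all of them in the cokernel. *)
Lemma socle_element : ~ annihilates alpha lambda X ->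
  exists2 z, ~ boundary z & forall i, i \in X -> boundary (form i *: z).
Proof.
move=> nann.
have ns : ~ boundary (s *: lam).
  move=> bs; apply: nann => c rc cX; apply/eqP.
  have := boundary_eval bs rc cX => /eqP; rewrite scaler_eq0 => /orP[|//].
  rewrite rmorph_prod => /prodf_eq0[i]; rewrite !inE /= meval_form_poly.
  by move/negP.
(* [m] bounds the factors still to be added; at 0 the list is long enough for [boundary_prod]. *)
suff H m t : {subset t <= X} -> (#|X| < size t + m)%N ->
    ~ boundary ((s * \prod_(i <- t) form i) *: lam) ->
    exists2 z, ~ boundary z & forall i, i \in X -> boundary (form i *: z).
  by apply: (H #|X|.+1 [::]); rewrite ?big_nil ?mulr1 ?leqnn.
elim: m t => [|m IHm] t tX tm nt.
  by rewrite addn0 in tm; case: nt; apply: boundary_prod.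
have [|nb] := EM (exists2 i, i \in X &
    ~ boundary ((s * \prod_(j <- i :: t) form j) *: lam)).
  case=> i iX; apply: IHm; last by rewrite addSnnS.
  by move=> j; rewrite inE => /orP[/eqP ->|/tX].
exists ((s * \prod_(i <- t) form i) *: lam) => // i iX; apply: contrapT => nbi.
by apply: nb; exists i; rewrite // big_cons mulrCA -scalerA.
Qed.

End Socle.

(** * From the socle element to the projective dimension *)

Theorem corollary6p4 (K : fieldType) (charK : [pchar K] =i pred0)
    (l n : nat) (alpha : 'I_n -> 'cV[K]_l.+1) (arrA : arrangement alpha)
    (k : nat) :
  [/\ has_nontrivial_weak_perspective alpha k.+1 ->
        projdim_ge (logder alpha) (k - 1),
      (3 <= k.+1)%N -> ~ generated alpha k.+1 ->
        projdim_ge (logder alpha) (k - 1) &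
      forall alpha0 : 'cV[K]_l.+1, general_position alpha k.+1 alpha0 ->
        (has_nontrivial_from alpha k.+1 alpha0 <-> ~ generated alpha k.+1)].
Proof.
have bound : ~ generated alpha k.+1 -> projdim_ge (logder alpha) (k - 1).
  move=> /not_generatedP[lambda [short nann]] d.
  have [v [nv vmin]] := minimal_zeros charK nann.
  have [z nz sz] := socle_element vmin nv.
  have [s [sX sfree]] := annihilates_rank_ge short nv.
  move=> /(projdim_lower_bound arrA sfree nz) bnd.
  (* The goal is rewritten as [k.+1 <= d.+2]: a regular sequence of [k.+1] forms against a complex
     two steps longer than the resolution. *)
  rewrite leq_subLR add1n -ltnS; apply: bnd => h /sX; exact: sz.
split=> // [[alpha0 nt]|alpha0]; last exact: has_nontrivialP.
have [_ [[gp _] _]] := nt; apply: bound; exact: (has_nontrivialP gp).1 nt.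
Qed.
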